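(* Let $\omega$ be a majorant for which there exist constants $\delta_0>0$ and $M>0$ with $$\int_0^{\delta}\frac{\omega(t)}{t}\,dt\le M\,\omega(\delta)\qquad\text{for all } 0<\delta<\delta_0,$$ and let $G$ be an $L_\omega$-extension domain. If $f$ is a real harmonic function in $G$ that is continuous up to the boundary $\partial G$, then $$f\in L_\omega(G)\iff |f|\in L_\omega(G)\iff |f|\in L_\omega(G,\partial G).$$
   Context: A majorant is a continuous increasing function $\omega:[0,\infty)\to[0,\infty)$ with $\omega(0)=0$ such that $\omega(t)/t$ is non-increasing for $t>0$. For $\Omega\subseteq\mathbb{C}$, $L_\omega(\Omega)$ is the set of functions $F:\Omega\to\mathbb{C}$ for which there is a constant $M>0$ with $|F(z)-F(w)|\le M\omega(|z-w|)$ for all $z,w\in\Omega$. For a domain $G$, $L_\omega(G,\partial G)$ is the class of continuous functions $F$ on $G\cup\partial G$ for which there is a constant $C>0$ with $|F(z)-F(w)|\le C\omega(|z-w|)$ whenever $z\in G$ and $w\in\partial G$. $d_G(z)$ is the Euclidean distance from $z\in G$ to $\partial G$. $\mathrm{loc}L_\omega(G)$ is the set of functions $F:G\to\mathbb{C}$ for which there is a fixed constant $M>0$ with $|F(z)-F(w)|\le M\omega(|z-w|)$ whenever $z,w\in G$ and $|z-w|<\frac12 d_G(z)$. A proper subdomain $G$ of $\mathbb{C}$ is called an $L_\omega$-extension domain if $L_\omega(G)=\mathrm{loc}L_\omega(G)$. ''Continuous up to the boundary'' means that $f$ is (extended to) a continuous function on $G\cup\partial G$. *)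

(* Defs.v *)
(* The plane is Coquelicot's C = R * R. Its uniform structure is the product
   one, which induces the same topology as the Euclidean modulus Cmod. *)
From Stdlib Require Import Reals.
From Coquelicot Require Import Coquelicot.

Open Scope R_scope.

(* A function on [0, oo) is represented by a total function on R whose values
   at negative arguments are irrelevant. "Increasing" is read in the weak
   sense, so strictly increasing majorants are included. *)
Record is_majorant (omega : R -> R) : Prop := {
  majorant_cont : continuous_on (fun t => 0 <= t) omega;
  majorant_nonneg : forall t, 0 <= t -> 0 <= omega t;
  majorant_incr : forall s t, 0 <= s -> s <= t -> omega s <= omega t;
  majorant_0 : omega 0 = 0;
  majorant_ratio : forall s t, 0 < s -> s <= t -> omega t / t <= omega s / s
}.

(* The integral is improper at 0, where omega t / t may be unbounded; its
   convergence is part of the condition. *)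
Definition integral_condition (omega : R -> R) : Prop :=
  exists delta0 M : R, 0 < delta0 /\ 0 < M /\
    forall delta, 0 < delta -> delta < delta0 ->
      exists I : R,
        is_RInt_gen (fun t => omega t / t) (at_right 0) (at_point delta) I /\
        I <= M * omega delta.

Definition closure (A : C -> Prop) (z : C) : Prop :=
  forall eps : R, 0 < eps -> exists w, A w /\ Cmod (w - z) < eps.

Definition boundary (A : C -> Prop) (z : C) : Prop :=
  closure A z /\ closure (fun w => ~ A w) z.

Definition connected (A : C -> Prop) : Prop :=
  forall U V : C -> Prop, open U -> open V ->
    (forall z, A z -> U z \/ V z) ->
    (exists z, A z /\ U z) -> (exists z, A z /\ V z) ->
    exists z, A z /\ U z /\ V z.

Definition is_domain (G : C -> Prop) : Prop :=
  open G /\ (exists z, G z) /\ connected G.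

(* The infimum is taken in Rbar; it is finite as soon as the boundary is
   nonempty, which is the case for every proper subdomain of C. *)
Definition dist_boundary (G : C -> Prop) (z : C) : R :=
  real (Glb_Rbar (fun r => exists w, boundary G w /\ r = Cmod (z - w))).

(* Functions on a subset of C are represented by total functions; each class
   below only constrains the values on the relevant subset. *)
Definition L_class (omega : R -> R) (Omega : C -> Prop) (F : C -> C) : Prop :=
  exists M : R, 0 < M /\
    forall z w, Omega z -> Omega w ->
      Cmod (F z - F w) <= M * omega (Cmod (z - w)).

Definition L_boundary (omega : R -> R) (G : C -> Prop) (F : C -> C) : Prop :=
  continuous_on (fun z => G z \/ boundary G z) F /\
  exists K : R, 0 < K /\
    forall z w, G z -> boundary G w ->
      Cmod (F z - F w) <= K * omega (Cmod (z - w)).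

Definition locL (omega : R -> R) (G : C -> Prop) (F : C -> C) : Prop :=
  exists M : R, 0 < M /\
    forall z w, G z -> G w -> Cmod (z - w) < / 2 * dist_boundary G z ->
      Cmod (F z - F w) <= M * omega (Cmod (z - w)).

Definition extension_domain (omega : R -> R) (G : C -> Prop) : Prop :=
  is_domain G /\ (exists z, ~ G z) /\
  forall F : C -> C, L_class omega G F <-> locL omega G F.

(* Class C^2 in the open set G, with vanishing Laplacian. *)
Definition harmonic (G : C -> Prop) (f : C -> R) : Prop :=
  forall x y : R, G (x, y) ->
    ex_diff_n (fun u v => f (u, v)) 2 x y /\
    partial_derive 2 0 (fun u v => f (u, v)) x y
      + partial_derive 0 2 (fun u v => f (u, v)) x y = 0.

(* Main.v *)
(** On the disc [B(z,d)] with [d] the distance from [z] to the boundary, compare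
    [f] with its value at a boundary point at distance less than [2d]: [|f|]
    oscillates by [O(omega d)] there. Hence so does [f]: either it has constant
    sign on the disc, or it vanishes somewhere and [|f|] itself is [O(omega d)].
    A harmonic function of oscillation [O(omega d)] on [B(z,d)] is Lipschitz on
    [B(z,d/2)] with constant [O(omega d / d)], and
    [omega d / d <= omega t / t] for [t <= d], so [f] lies in [locL], which is
    [L_class] on an extension domain. The Lipschitz bound is obtained from the
    maximum principle alone, by bounding symmetric differences with a barrier. *)

Require Import Defs.
From Stdlib Require Import Reals Lra Classical ClassicalEpsilon.
From Coquelicot Require Import Coquelicot.

Open Scope R_scope.

(** * The maximum principle on rectangles *)

(** If [l] were positive, [dphi] would lie strictly above [dphi x0] just to the right of [x0] and
    strictly below it just to the left, so [phi] would exceed [phi x0] on one of the two sides. *)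
Lemma second_derivative_at_max (phi dphi : R -> R) (x0 l : R) :
  locally x0 (fun x => is_derive phi x (dphi x)) ->
  is_derive dphi x0 l ->
  locally x0 (fun x => phi x <= phi x0) ->
  l <= 0.
Proof.
  intros [d1 H1] H2 [d2 H3].
  apply Rnot_lt_le; intros Hl.
  apply is_derive_Reals in H2.
  (* Tolerance [l] around the limit [l] forces the difference quotients of [dphi] to be positive. *)
  destruct (H2 l Hl) as [d3 H4].
  set (r := Rmin d1 (Rmin d2 d3) / 2).
  assert (Hr : 0 < r /\ r < d1 /\ r < d2 /\ r < d3).
  { pose proof (cond_pos d1). pose proof (cond_pos d2). pose proof (cond_pos d3).
    unfold r, Rmin. repeat destruct Rle_dec; lra. }
  assert (Hderiv : forall c, Rabs (c - x0) <= r -> derivable_pt_lim phi c (dphi c)).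
  { intros c Hc. apply is_derive_Reals, H1.
    change (Rabs (c - x0) < d1). lra. }
  assert (Hmono : forall c, c <> x0 -> Rabs (c - x0) <= r ->
    0 < (dphi c - dphi x0) * (c - x0)).
  { intros c Hc0 Hc.
    assert (Hq := H4 (c - x0) ltac:(lra) ltac:(lra)).
    replace (x0 + (c - x0)) with c in Hq by ring.
    apply Rabs_def2 in Hq.
    replace ((dphi c - dphi x0) * (c - x0))
      with ((dphi c - dphi x0) / (c - x0) * (c - x0) ^ 2) by (field; lra).
    apply Rmult_lt_0_compat; [lra | apply pow2_gt_0; lra]. }
  assert (Hmax : forall c, Rabs (c - x0) <= r -> phi c <= phi x0).
  { intros c Hc. apply H3. change (Rabs (c - x0) < d2). lra. }
  (* The sign of [dphi x0] decides on which side the mean value theorem gives a value above the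
     maximum. *)
  destruct (Rle_dec 0 (dphi x0)) as [Hs | Hs].
  - destruct (MVT_cor2 phi dphi x0 (x0 + r)) as [c [Hc1 Hc2]]; [lra | |].
    { intros c Hc. apply Hderiv. rewrite Rabs_pos_eq; lra. }
    assert (Hc3 := Hmono c ltac:(lra) ltac:(rewrite Rabs_pos_eq; lra)).
    assert (Hc4 := Hmax (x0 + r) ltac:(rewrite Rabs_pos_eq; lra)).
    assert (0 < dphi c) by (apply Rnot_le_lt; intros ?; nra).
    nra.
  - destruct (MVT_cor2 phi dphi (x0 - r) x0) as [c [Hc1 Hc2]]; [lra | |].
    { intros c Hc. apply Hderiv. rewrite Rabs_left1; lra. }
    assert (Hc3 := Hmono c ltac:(lra) ltac:(rewrite Rabs_left1; lra)).
    assert (Hc4 := Hmax (x0 - r) ltac:(rewrite Rabs_left1; lra)).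
    assert (dphi c < 0) by (apply Rnot_le_lt; intros ?; nra).
    nra.
Qed.

(** Compactness as a passage from local to uniform: the local radii form a gauge, every point of the
    rectangle is close to a point whose radius is at least a common [d], and [P] survives shrinking
    the radius to [d]. *)
Lemma rectangle_uniform (P : R -> R -> R -> Prop) (a b a' b' : R) :
  (forall d e x y, 0 < d -> d <= e -> P e x y -> P d x y) ->
  (forall u v, a <= u <= b -> a' <= v <= b' ->
     exists d : posreal, forall x y,
       Rabs (x - u) < d -> Rabs (y - v) < d -> P d x y) ->
  exists d : posreal, forall x y, a <= x <= b -> a' <= y <= b' -> P d x y.
Proof.
  intros Hmon Hloc.
  (* The gauge has to be total, so points outside the rectangle get the dummy radius 1. *)
  assert (Hex : forall u v, exists d : posreal, a <= u <= b -> a' <= v <= b' ->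
     forall x y, Rabs (x - u) < d -> Rabs (y - v) < d -> P d x y).
  { intros u v.
    destruct (classic (a <= u <= b /\ a' <= v <= b')) as [[Hu Hv] | Hn].
    - destruct (Hloc u v Hu Hv) as [d Hd]. now exists d.
    - exists (mkposreal 1 Rlt_0_1). tauto. }
  set (delta := fun u v => proj1_sig (constructive_indefinite_description _ (Hex u v))).
  destruct (compactness_value_2d a b a' b' delta) as [d Hd].
  exists d. intros x y Hx Hy. apply NNPP. intros Hn.
  apply (Hd x y Hx Hy). intros [u [v [Hu [Hv [Hxu [Hyv Hduv]]]]]].
  apply Hn, (Hmon d (delta u v)); [apply cond_pos | exact Hduv |].
  unfold delta in *. destruct (constructive_indefinite_description _ (Hex u v)).
  simpl in *. auto.
Qed.

(** Uniformity is used twice: with the bound [/ d] it makes [v] bounded above, so a supremum [S]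
    exists; if [S] were not attained, the bound [S - d] would hold uniformly and contradict
    leastness. *)
Lemma rectangle_max (v : R -> R -> R) (a b a' b' : R) :
  a <= b -> a' <= b' ->
  (forall x y, a <= x <= b -> a' <= y <= b' -> continuity_2d_pt v x y) ->
  exists x0 y0, a <= x0 <= b /\ a' <= y0 <= b' /\
    forall x y, a <= x <= b -> a' <= y <= b' -> v x y <= v x0 y0.
Proof.
  intros Hab Hab' Hc.
  destruct (rectangle_uniform (fun d x y => v x y <= / d) a b a' b') as [d Hd].
  { intros d e x y H0 Hde He. apply Rle_trans with (1 := He).
    now apply Rinv_le_contravar. }
  { intros p q Hp Hq.
    destruct (Hc p q Hp Hq (mkposreal 1 Rlt_0_1)) as [d Hd]. simpl in Hd.
    pose proof (cond_pos d) as Hd0. pose proof (Rabs_pos (v p q)) as Hv0.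
    assert (Hi : 0 < / (Rabs (v p q) + 1)) by (apply Rinv_0_lt_compat; lra).
    assert (Hm : 0 < Rmin d (/ (Rabs (v p q) + 1))) by (apply Rmin_pos; lra).
    exists (mkposreal _ Hm). simpl. intros x y Hx Hy.
    assert (Hxy : Rabs (v x y - v p q) < 1).
    { apply Hd; eapply Rlt_le_trans; eauto; apply Rmin_l. }
    apply Rabs_def2 in Hxy. pose proof (Rle_abs (v p q)).
    apply Rle_trans with (Rabs (v p q) + 1); [lra |].
    rewrite <- (Rinv_inv (Rabs (v p q) + 1)) at 1.
    apply Rinv_le_contravar; [exact Hm | apply Rmin_r]. }
  destruct (completeness (fun r => exists x y, a <= x <= b /\ a' <= y <= b' /\ r = v x y))
    as [S [HS1 HS2]].
  { exists (/ d). intros r [x [y [Hx [Hy ->]]]]. now apply Hd. }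
  { exists (v a a'), a, a'. repeat split; lra. }
  apply NNPP. intros Hno.
  assert (Hlt : forall x y, a <= x <= b -> a' <= y <= b' -> v x y < S).
  { intros x y Hx Hy. apply Rnot_le_lt. intros HS. apply Hno. exists x, y.
    split; [exact Hx | split; [exact Hy |]]. intros x' y' Hx' Hy'.
    apply Rle_trans with S; [apply HS1; eauto 6 | exact HS]. }
  destruct (rectangle_uniform (fun d x y => v x y <= S - d) a b a' b') as [e He].
  { intros; lra. }
  { intros p q Hp Hq. pose proof (Hlt p q Hp Hq) as Hpq.
    assert (Hg : 0 < (S - v p q) / 2) by lra.
    destruct (Hc p q Hp Hq (mkposreal _ Hg)) as [e He]. simpl in He.
    assert (Hm : 0 < Rmin e ((S - v p q) / 2)) by (apply Rmin_pos; [apply cond_pos | lra]).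
    exists (mkposreal _ Hm). simpl. intros x y Hx Hy.
    assert (Hxy : Rabs (v x y - v p q) < (S - v p q) / 2).
    { apply He; eapply Rlt_le_trans; eauto; apply Rmin_l. }
    apply Rabs_def2 in Hxy. pose proof (Rmin_r e ((S - v p q) / 2)). lra. }
  assert (HSe : S <= S - e).
  { apply HS2. intros r [x [y [Hx [Hy ->]]]]. now apply He. }
  pose proof (cond_pos e). lra.
Qed.

(** At an interior maximum both pure second derivatives are nonpositive, against the positive
    Laplacian; so the maximum sits on a side. *)
Lemma strictly_subharmonic_nonpos (v vx vy vxx vyy : R -> R -> R) (a b a' b' : R) :
  a <= b -> a' <= b' ->
  (forall x y, a <= x <= b -> a' <= y <= b' -> continuity_2d_pt v x y) ->
  (forall x y, a < x < b -> a' < y < b' ->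
     is_derive (fun t => v t y) x (vx x y) /\
     is_derive (fun t => v x t) y (vy x y) /\
     is_derive (fun t => vx t y) x (vxx x y) /\
     is_derive (fun t => vy x t) y (vyy x y) /\
     0 < vxx x y + vyy x y) ->
  (forall x y, a <= x <= b -> a' <= y <= b' ->
     x = a \/ x = b \/ y = a' \/ y = b' -> v x y <= 0) ->
  forall x y, a <= x <= b -> a' <= y <= b' -> v x y <= 0.
Proof.
  intros Hab Hab' Hc Hd Hbd x y Hx Hy.
  destruct (rectangle_max v a b a' b' Hab Hab' Hc) as [x0 [y0 [Hx0 [Hy0 Hmax]]]].
  apply Rle_trans with (1 := Hmax x y Hx Hy).
  destruct (classic (x0 = a \/ x0 = b \/ y0 = a' \/ y0 = b')) as [Hb | Hi]; [auto |].
  exfalso.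
  assert (Hx0' : a < x0 < b) by (split; apply Rnot_le_lt; intros ?; apply Hi; lra).
  assert (Hy0' : a' < y0 < b') by (split; apply Rnot_le_lt; intros ?; apply Hi; lra).
  assert (Hnear : forall p q r, p < r < q -> locally r (fun t => p < t < q)).
  { intros p q r Hr. assert (He : 0 < Rmin (r - p) (q - r)) by (apply Rmin_pos; lra).
    exists (mkposreal _ He). intros t Ht. change (Rabs (t - r) < Rmin (r - p) (q - r)) in Ht.
    pose proof (Rmin_l (r - p) (q - r)). pose proof (Rmin_r (r - p) (q - r)).
    apply Rabs_def2 in Ht. lra. }
  assert (H1 : vxx x0 y0 <= 0).
  { apply (second_derivative_at_max (fun t => v t y0) (fun t => vx t y0) x0).
    - apply filter_imp with (2 := Hnear a b x0 Hx0'). intros t Ht. now apply Hd.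
    - now apply Hd.
    - apply filter_imp with (2 := Hnear a b x0 Hx0'). intros t Ht. apply Hmax; lra. }
  assert (H2 : vyy x0 y0 <= 0).
  { apply (second_derivative_at_max (fun t => v x0 t) (fun t => vy x0 t) y0).
    - apply filter_imp with (2 := Hnear a' b' y0 Hy0'). intros t Ht. now apply Hd.
    - now apply Hd.
    - apply filter_imp with (2 := Hnear a' b' y0 Hy0'). intros t Ht. apply Hmax; lra. }
  pose proof (Hd x0 y0 Hx0' Hy0'). lra.
Qed.

(** * Symmetric differences of harmonic functions on a square *)

Lemma is_derive_shift (f : R -> R) (a x l : R) :
  is_derive f (a + x) l -> is_derive (fun t => f (a + t)) x l.
Proof.
  intros H. evar_last.
  - apply (is_derive_comp f (fun t => a + t)); [exact H |].
    auto_derive; [exact I | reflexivity].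
  - apply Rmult_1_l.
Qed.

Lemma is_derive_reflect (f : R -> R) (a x l : R) :
  is_derive f (a - x) l -> is_derive (fun t => f (a - t)) x (- l).
Proof.
  intros H. evar_last.
  - apply (is_derive_comp f (fun t => a - t)); [exact H |].
    auto_derive; [exact I | reflexivity].
  - unfold scal; simpl; unfold mult; simpl. ring.
Qed.

Lemma is_derive_scaled_difference (k : R) (f1 f2 q : R -> R) (x l1 l2 l3 l : R) :
  is_derive f1 x l1 -> is_derive f2 x l2 -> is_derive q x l3 ->
  l = k * (l1 - l2) - l3 ->
  is_derive (fun t => k * (f1 t - f2 t) - q t) x l.
Proof.
  intros H1 H2 H3 ->.
  apply (is_derive_minus (fun t => k * (f1 t - f2 t)) q); [| exact H3].
  apply is_derive_scal. now apply (is_derive_minus f1 f2).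
Qed.

(** The sign [e] treats the translated copy and the reflected copy of [u] together. *)
Lemma continuity_2d_pt_reflect (u : R -> R -> R) (e a b x y : R) :
  Rabs e = 1 ->
  continuity_2d_pt u (a + e * x) (b + y) ->
  continuity_2d_pt (fun p q => u (a + e * p) (b + q)) x y.
Proof.
  intros He H eps. destruct (H eps) as [d Hd]. exists d. intros p q Hp Hq.
  apply Hd.
  - replace (a + e * p - (a + e * x)) with (e * (p - x)) by ring.
    now rewrite Rabs_mult, He, Rmult_1_l.
  - now replace (b + q - (b + y)) with (q - y) by ring.
Qed.

(* The odd part of [u] in the first variable is compared with the strictly
   superharmonic barrier [M / s^2 * (y * y + x * (3 * s - 2 * x))], which is
   nonnegative on the axis of reflection and at least [M] on the other three
   sides of the half square. *)
Lemma harmonic_symmetric_difference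
    (u ux uy uxx uyy : R -> R -> R) (a b s M : R) :
  0 < s -> 0 <= M ->
  (forall x y, Rabs (x - a) <= s -> Rabs (y - b) <= s ->
     continuity_2d_pt u x y /\
     is_derive (fun t => u t y) x (ux x y) /\
     is_derive (fun t => u x t) y (uy x y) /\
     is_derive (fun t => ux t y) x (uxx x y) /\
     is_derive (fun t => uy x t) y (uyy x y) /\
     uxx x y + uyy x y = 0) ->
  (forall x y x' y', Rabs (x - a) <= s -> Rabs (y - b) <= s ->
     Rabs (x' - a) <= s -> Rabs (y' - b) <= s ->
     Rabs (u x y - u x' y') <= 2 * M) ->
  forall h, 0 <= h <= s -> Rabs (u (a + h) b - u (a - h) b) <= 6 * M * h / s.
Proof.
  intros Hs HM Hu Hosc h Hh.
  assert (Hsq : forall x y, 0 <= x <= s -> - s <= y <= s ->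
    Rabs (a + x - a) <= s /\ Rabs (a - x - a) <= s /\ Rabs (b + y - b) <= s).
  { intros x y Hx Hy. repeat split; apply Rabs_le; lra. }
  (* The case [M = 0] is split off so that the barrier has a positive coefficient and the comparison
     is strict. *)
  destruct (Req_dec M 0) as [HM0 | HM0].
  { assert (H := Hosc (a + h) (b + 0) (a - h) (b + 0)).
    destruct (Hsq h 0) as [H1 [H2 H3]]; try lra.
    specialize (H H1 H3 H2 H3). rewrite Rplus_0_r in H. rewrite HM0 in *. lra. }
  assert (Hk : 0 < M / s ^ 2) by (apply Rdiv_lt_0_compat; [lra | apply pow_lt, Hs]).
  assert (Hkm : M / s ^ 2 * s ^ 2 = M) by (field; lra).
  assert (Hkh : M / s ^ 2 * (h * (3 * s)) = 6 * M * h / s / 2) by (field; lra).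
  set (c := M / s ^ 2) in *. clearbody c.
  (* The values 1/2 and -1/2 of [k] give the two signs of the absolute value; the factor 1/2 turns
     the oscillation [2 * M] into [M]. *)
  assert (Hsigned : forall k, Rabs k = / 2 ->
    k * (u (a + h) b - u (a - h) b) <= 6 * M * h / s / 2).
  { intros k Hkabs.
    set (v := fun x y => k * (u (a + x) (b + y) - u (a - x) (b + y))
                         - c * (y * y + x * (3 * s - 2 * x))).
    assert (Hv : v h 0 <= 0).
    { apply (strictly_subharmonic_nonpos v
        (fun x y => k * (ux (a + x) (b + y) - - ux (a - x) (b + y)) - c * (3 * s - 4 * x))
        (fun x y => k * (uy (a + x) (b + y) - uy (a - x) (b + y)) - c * (2 * y))
        (fun x y => k * (uxx (a + x) (b + y) - uxx (a - x) (b + y)) - c * (- 4))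
        (fun x y => k * (uyy (a + x) (b + y) - uyy (a - x) (b + y)) - c * 2)
        0 s (- s) s); try lra.
      - intros x y Hx Hy. destruct (Hsq x y Hx Hy) as [H1 [H2 H3]].
        destruct (Hu _ _ H1 H3) as [C1 _]. destruct (Hu _ _ H2 H3) as [C2 _].
        apply continuity_2d_pt_minus.
        + apply continuity_2d_pt_mult; [apply continuity_2d_pt_const |].
          apply continuity_2d_pt_minus.
          * apply continuity_2d_pt_ext with (fun p q => u (a + 1 * p) (b + q)).
            { intros p q. now rewrite Rmult_1_l. }
            apply continuity_2d_pt_reflect; [apply Rabs_R1 | now rewrite Rmult_1_l].
          * apply continuity_2d_pt_ext with (fun p q => u (a + -1 * p) (b + q)).
            { intros p q. f_equal. ring. }
            apply continuity_2d_pt_reflect; [rewrite Rabs_left; lra |].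
            now replace (a + -1 * x) with (a - x) by ring.
        + repeat first [ apply continuity_2d_pt_const | apply continuity_2d_pt_id1
            | apply continuity_2d_pt_id2 | apply continuity_2d_pt_mult
            | apply continuity_2d_pt_minus | apply continuity_2d_pt_plus ].
      - intros x y Hx Hy.
        destruct (Hsq x y) as [H1 [H2 H3]]; try lra.
        destruct (Hu _ _ H1 H3) as [_ [A1 [A2 [A3 [A4 A5]]]]].
        destruct (Hu _ _ H2 H3) as [_ [B1 [B2 [B3 [B4 B5]]]]].
        split; [| split; [| split; [| split]]].
        + eapply is_derive_scaled_difference.
          * apply (is_derive_shift (fun t => u t (b + y))), A1.
          * apply (is_derive_reflect (fun t => u t (b + y))), B1.
          * auto_derive; [exact I | reflexivity].
          * ring.
        + eapply is_derive_scaled_difference.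
          * apply (is_derive_shift (fun t => u (a + x) t)), A2.
          * apply (is_derive_shift (fun t => u (a - x) t)), B2.
          * auto_derive; [exact I | reflexivity].
          * ring.
        + eapply is_derive_scaled_difference.
          * apply (is_derive_shift (fun t => ux t (b + y))), A3.
          (* The reflected copy changes sign at each of the two differentiations in [x]. *)
          * apply (is_derive_opp (fun t => ux (a - t) (b + y))).
            apply (is_derive_reflect (fun t => ux t (b + y))), B3.
          * auto_derive; [exact I | reflexivity].
          * unfold opp; simpl. ring.
        + eapply is_derive_scaled_difference.
          * apply (is_derive_shift (fun t => uy (a + x) t)), A4.
          * apply (is_derive_shift (fun t => uy (a - x) t)), B4.
          * auto_derive; [exact I | reflexivity].
          * ring.
        (* Harmonicity cancels the terms in [u], and the barrier leaves the Laplacian [2 * c]. *)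
        + replace (uxx (a + x) (b + y)) with (- uyy (a + x) (b + y)) by lra.
          replace (uxx (a - x) (b + y)) with (- uyy (a - x) (b + y)) by lra.
          lra.
      - intros x y Hx Hy Hside. unfold v.
        destruct (Hsq x y Hx Hy) as [H1 [H2 H3]].
        assert (HkM : k * (u (a + x) (b + y) - u (a - x) (b + y)) <= M).
        { apply Rle_trans with (1 := Rle_abs _). rewrite Rabs_mult, Hkabs.
          pose proof (Hosc _ _ _ _ H1 H3 H2 H3). lra. }
        destruct Hside as [-> | Hside].
        { rewrite Rplus_0_r, Rminus_0_r. nra. }
        assert (s ^ 2 <= y * y + x * (3 * s - 2 * x)).
        { destruct Hside as [-> | [-> | ->]]; nra. }
        nra. }
    (* At [(h, 0)] the barrier is [c * h * (3 * s - 2 * h)], at most [3 * c * s * h], which is the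
       claimed bound. *)
    unfold v in Hv. rewrite Rplus_0_r in Hv. nra. }
  pose proof (Hsigned (/ 2) ltac:(rewrite Rabs_pos_eq; lra)).
  pose proof (Hsigned (- / 2) ltac:(rewrite Rabs_left; lra)).
  apply Rabs_le. lra.
Qed.

(** * The Euclidean modulus and the product topology *)

Lemma Cmod_le_components (z w : C) :
  Rabs (fst z) <= Rabs (fst w) -> Rabs (snd z) <= Rabs (snd w) -> Cmod z <= Cmod w.
Proof.
  intros H1 H2. apply sqrt_le_1_alt. rewrite <- !Rsqr_pow2.
  apply Rplus_le_compat; now apply Rsqr_le_abs_1.
Qed.

Lemma Cmod_le_sum (x y : R) : Cmod (x, y) <= Rabs x + Rabs y.
Proof.
  pose proof (Rabs_pos x). pose proof (Rabs_pos y).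
  rewrite <- (sqrt_pow2 (Rabs x + Rabs y)) by lra.
  apply sqrt_le_1_alt. simpl fst; simpl snd.
  rewrite <- (pow2_abs x), <- (pow2_abs y). nra.
Qed.

Lemma Cmod_ge_components (x y : R) : Rabs x <= Cmod (x, y) /\ Rabs y <= Cmod (x, y).
Proof.
  pose proof (Rmax_Cmod (x, y)) as H. simpl fst in H; simpl snd in H.
  pose proof (Rmax_l (Rabs x) (Rabs y)). pose proof (Rmax_r (Rabs x) (Rabs y)). lra.
Qed.

Lemma Cmod_minus_sym (z w : C) : Cmod (z - w) = Cmod (w - z).
Proof. rewrite <- Cmod_opp. f_equal. ring. Qed.

Lemma Cmod_minus_triangle (z w p : C) : Cmod (z - p) <= Cmod (z - w) + Cmod (w - p).
Proof. replace (z - p)%C with ((z - w) + (w - p))%C by ring. apply Cmod_triangle. Qed.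

Lemma ball_of_Cmod (z w : C) (e : R) : Cmod (w - z) < e -> ball z e w.
Proof.
  destruct z as [x y], w as [x' y']. intros H.
  destruct (Cmod_ge_components (x' - x) (y' - y)).
  change (Cmod (x' - x, y' - y) < e) in H.
  split; [change (Rabs (x' - x) < e) | change (Rabs (y' - y) < e)]; lra.
Qed.

Lemma Cmod_RtoC_minus (a b : R) : Cmod (RtoC a - RtoC b) = Rabs (a - b).
Proof. now rewrite <- RtoC_minus, Cmod_R. Qed.

Lemma open_Cmod (G : C -> Prop) (z : C) :
  open G -> G z -> exists d, 0 < d /\ forall w, Cmod (w - z) < d -> G w.
Proof.
  intros HG Hz. destruct (HG z Hz) as [d Hd].
  exists d. split; [apply cond_pos |]. intros w Hw. apply Hd, ball_of_Cmod, Hw.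
Qed.

Lemma continuous_on_Cmod (D : C -> Prop) (f : C -> R) (z : C) (e : R) :
  continuous_on D f -> D z -> 0 < e ->
  exists d, 0 < d /\ forall w, D w -> Cmod (w - z) < d -> Rabs (f w - f z) < e.
Proof.
  intros Hf Hz He.
  assert (Hl : locally (f z) (fun r => Rabs (r - f z) < e)) by now exists (mkposreal e He).
  destruct (Hf z Hz _ Hl) as [d Hd].
  exists d. split; [apply cond_pos |]. intros w Hw Hwz. now apply Hd; [apply ball_of_Cmod |].
Qed.

(** * Segments and the distance to the boundary *)

Definition segment (z w : C) (t : R) : C := (z + RtoC t * (w - z))%C.

Lemma Cmod_segment (z w : C) (t t' : R) :
  Cmod (segment z w t - segment z w t') = Rabs (t - t') * Cmod (w - z).
Proof.
  unfold segment. rewrite <- Cmod_R, <- Cmod_mult, RtoC_minus. f_equal. ring.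
Qed.

Lemma segment_0 (z w : C) : segment z w 0 = z.
Proof. unfold segment. ring. Qed.

Lemma segment_1 (z w : C) : segment z w 1 = w.
Proof. unfold segment. ring. Qed.

(** Take the supremum [m] of the parameters whose points lie in [G]: points of [G] occur at
    parameters arbitrarily close to [m] from below, and every later parameter up to 1 gives a point
    outside. *)
Lemma segment_meets_boundary (G : C -> Prop) (z w : C) :
  G z -> ~ G w -> exists p, boundary G p /\ Cmod (z - p) <= Cmod (z - w).
Proof.
  intros Hz Hw.
  destruct (completeness (fun t => 0 <= t <= 1 /\ G (segment z w t))) as [m [Hm1 Hm2]].
  { exists 1. intros t Ht. apply Ht. }
  { exists 0. rewrite segment_0. split; [lra | exact Hz]. }
  assert (Hm0 : 0 <= m) by (apply Hm1; rewrite segment_0; split; [lra | exact Hz]).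
  assert (Hm3 : m <= 1) by (apply Hm2; intros t Ht; apply Ht).
  pose proof (Cmod_ge_0 (w - z)) as HL.
  assert (Hclose : forall eps, 0 < eps -> exists r, 0 < r /\
    forall t, Rabs (t - m) <= r -> Cmod (segment z w t - segment z w m) < eps).
  (* The added 1 keeps the denominator positive whatever [w - z] is. *)
  { intros eps Heps. exists (eps / (Cmod (w - z) + 1)).
    assert (Hr : 0 < eps / (Cmod (w - z) + 1)) by (apply Rdiv_lt_0_compat; lra).
    split; [exact Hr |].
    intros t Ht. rewrite Cmod_segment.
    apply Rle_lt_trans with (eps / (Cmod (w - z) + 1) * Cmod (w - z)).
    - now apply Rmult_le_compat_r.
    - assert (eps / (Cmod (w - z) + 1) * (Cmod (w - z) + 1) = eps) by (field; lra). lra. }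
  exists (segment z w m). split; [split |].
  - intros eps Heps. destruct (Hclose eps Heps) as [r [Hr Hnear]].
    destruct (classic (exists t, (0 <= t <= 1 /\ G (segment z w t)) /\ m - r < t))
      as [[t [Ht1 Ht2]] | Hno].
    + exists (segment z w t). split; [apply Ht1 | apply Hnear].
      assert (t <= m) by now apply Hm1. apply Rabs_le; lra.
    + assert (m <= m - r); [| lra].
      apply Hm2. intros t Ht. apply Rnot_lt_le. intros Hlt. apply Hno. eauto.
  - intros eps Heps. destruct (Hclose eps Heps) as [r [Hr Hnear]].
    (* If [m = 1] no later parameter is left, but the endpoint [w] is itself outside [G]. *)
    destruct (Req_dec m 1) as [-> | Hne].
    + exists w. split; [exact Hw |]. rewrite <- (segment_1 z w) at 1.
      apply Hnear. rewrite Rminus_diag, Rabs_R0. lra.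
    + exists (segment z w (Rmin 1 (m + r))).
      assert (Ht : m < Rmin 1 (m + r) <= 1 /\ Rmin 1 (m + r) <= m + r).
      { split; [split |]; [apply Rmin_glb_lt; lra | apply Rmin_l | apply Rmin_r]. }
      split.
      * intros HGt. assert (Rmin 1 (m + r) <= m); [| lra].
        apply Hm1. split; [lra | exact HGt].
      * apply Hnear, Rabs_le. lra.
  - rewrite <- (segment_0 z w) at 1. rewrite Cmod_segment, (Cmod_minus_sym z w).
    rewrite Rminus_0_l, Rabs_Ropp, Rabs_pos_eq by exact Hm0. nra.
Qed.

(** A segment from [z] to an outside point supplies a boundary point, so the infimum is finite. It
    is positive because a boundary point within [r / 2] of [z] would bring outside points into a
    disc of radius [r] contained in [G]. *)
Lemma dist_boundary_spec (G : C -> Prop) (z : C) :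
  open G -> G z -> (exists w, ~ G w) ->
  0 < dist_boundary G z /\
  (forall p, boundary G p -> dist_boundary G z <= Cmod (z - p)) /\
  (forall e, dist_boundary G z < e -> exists p, boundary G p /\ Cmod (z - p) < e).
Proof.
  intros HG Hz [w Hw].
  destruct (segment_meets_boundary G z w Hz Hw) as [p [Hp _]].
  destruct (open_Cmod G z HG Hz) as [r [Hr HGr]].
  assert (Hfar : forall q, boundary G q -> r / 2 <= Cmod (z - q)).
  { intros q [_ Hq]. apply Rnot_lt_le. intros Hlt.
    destruct (Hq (r / 2)) as [q' [Hq' Hd]]; [lra |].
    apply Hq', HGr. pose proof (Cmod_minus_triangle q' q z).
    rewrite (Cmod_minus_sym q z) in *. lra. }
  unfold dist_boundary.
  destruct (Glb_Rbar_correct (fun r => exists w, boundary G w /\ r = Cmod (z - w)))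
    as [Hlb Hglb].
  set (g := Glb_Rbar _) in *.
  assert (H1 : Rbar_le (r / 2) g).
  { apply Hglb. intros x [q [Hq ->]]. apply Hfar, Hq. }
  assert (H2 : forall q, boundary G q -> Rbar_le g (Cmod (z - q))).
  { intros q Hq. apply Hlb. now exists q. }
  pose proof (H2 p Hp) as H3.
  destruct g as [g | |]; simpl in *; try contradiction.
  split; [lra | split; [exact H2 |]].
  intros e He. apply NNPP. intros Hno.
  assert (H4 : Rbar_le e g); [| simpl in H4; lra].
  apply Hglb. intros x [q [Hq ->]]. simpl. apply Rnot_lt_le. intros Hlt.
  apply Hno. now exists q.
Qed.

(** A point outside [G] would yield a boundary point at least as close to [z]. *)
Lemma disc_in_domain (G : C -> Prop) (z w : C) :
  open G -> G z -> Cmod (z - w) < dist_boundary G z -> G w.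
Proof.
  intros HG Hz Hzw. apply NNPP. intros Hw.
  destruct (segment_meets_boundary G z w Hz Hw) as [p [Hp Hzp]].
  destruct (dist_boundary_spec G z HG Hz (ex_intro _ w Hw)) as [_ [H _]].
  pose proof (H p Hp). lra.
Qed.

(** * From the oscillation of the absolute value to that of the function *)

(** The disc is convex, so the intermediate value theorem applies along the segment from [p] to
    [q]. *)
Lemma sign_change_zero (f : C -> R) (z : C) (d : R) (p q : C) :
  continuous_on (fun w => Cmod (z - w) < d) f ->
  Cmod (z - p) < d -> Cmod (z - q) < d -> f p < 0 < f q ->
  exists w, Cmod (z - w) < d /\ f w = 0.
Proof.
  intros Hf Hp Hq [Hfp Hfq].
  assert (Hin : forall t, 0 <= t <= 1 -> Cmod (z - segment p q t) < d).
  { intros t Ht.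
    replace (z - segment p q t)%C
      with (RtoC (1 - t) * (z - p) + RtoC t * (z - q))%C
      by (unfold segment; rewrite RtoC_minus; ring).
    apply Rle_lt_trans with (1 := Cmod_triangle _ _).
    rewrite !Cmod_mult, !Cmod_R, !Rabs_pos_eq by lra.
    destruct (Rlt_dec 0 t); nra. }
  destruct (Ranalysis5.IVT_interv (fun t => f (segment p q t)) 0 1) as [t [Ht Hft]].
  - intros t Ht. apply continuity_pt_locally. intros eps.
    destruct (continuous_on_Cmod _ f _ eps Hf (Hin t Ht) (cond_pos eps)) as [r [Hr Hnear]].
    (* Continuity is two-sided, so nearby parameters may leave the unit interval; the second bound
       still keeps their points in the disc. *)
    set (m := Rmin r (d - Cmod (z - segment p q t))).
    assert (Hm : 0 < m / (Cmod (q - p) + 1)).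
    { pose proof (Hin t Ht). pose proof (Cmod_ge_0 (q - p)).
      apply Rdiv_lt_0_compat; [apply Rmin_pos |]; lra. }
    exists (mkposreal _ Hm). intros x Hx.
    change (Rabs (x - t) < m / (Cmod (q - p) + 1)) in Hx.
    assert (Hxt : Cmod (segment p q x - segment p q t) < m).
    { rewrite Cmod_segment. pose proof (Cmod_ge_0 (q - p)).
      assert (m / (Cmod (q - p) + 1) * (Cmod (q - p) + 1) = m) by (field; lra). nra. }
    assert (Hmr : m <= r) by apply Rmin_l.
    assert (Hmd : m <= d - Cmod (z - segment p q t)) by apply Rmin_r.
    apply Hnear; [| lra].
    pose proof (Cmod_minus_triangle z (segment p q t) (segment p q x)).
    rewrite (Cmod_minus_sym (segment p q t) (segment p q x)) in *. lra.
  - lra.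
  - now rewrite segment_0.
  - now rewrite segment_1.
  - exists (segment p q t). auto.
Qed.

(** With equal signs the difference is that of the absolute values, at most [2 * E]. With opposite
    signs a zero of [f] forces [Rabs r <= E], so each absolute value is at most [2 * E] and the
    difference at most [4 * E]. *)
Lemma oscillation_from_abs (f : C -> R) (z : C) (d r E : R) :
  continuous_on (fun w => Cmod (z - w) < d) f ->
  (forall w, Cmod (z - w) < d -> Rabs (Rabs (f w) - r) <= E) ->
  forall p q, Cmod (z - p) < d -> Cmod (z - q) < d -> Rabs (f p - f q) <= 4 * E.
Proof.
  intros Hf Habs p q Hp Hq.
  assert (Hzero : f p < 0 < f q \/ f q < 0 < f p -> Rabs r <= E).
  { intros H.
    assert (Hw : exists w, Cmod (z - w) < d /\ f w = 0).
    { destruct H; [apply (sign_change_zero f z d p q) | apply (sign_change_zero f z d q p)];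
      assumption. }
    destruct Hw as [w [Hw Hfw]]. pose proof (Habs w Hw) as H0.
    now rewrite Hfw, Rabs_R0, Rminus_0_l, Rabs_Ropp in H0. }
  pose proof (Habs p Hp) as H1. pose proof (Habs q Hq) as H2.
  apply Rabs_le_between in H1, H2.
  destruct (Rlt_dec (f p) 0), (Rlt_dec (f q) 0), (Rlt_dec 0 (f p)), (Rlt_dec 0 (f q));
    try lra;
    try (assert (Hr : Rabs r <= E) by (apply Hzero; lra); apply Rabs_le_between in Hr);
    apply Rabs_le; unfold Rabs in H1, H2; repeat destruct Rcase_abs; lra.
Qed.

(** * The Lipschitz estimate on the half disc *)

Lemma harmonic_partials (G : C -> Prop) (f : C -> R) (x y : R) :
  harmonic G f -> G (x, y) ->
  let u := fun a b => f (a, b) in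
  let ux := fun a b => Derive (fun t => u t b) a in
  let uy := fun a b => Derive (fun t => u a t) b in
  continuity_2d_pt u x y /\
  is_derive (fun t => u t y) x (ux x y) /\
  is_derive (fun t => u x t) y (uy x y) /\
  is_derive (fun t => ux t y) x (Derive (fun t => ux t y) x) /\
  is_derive (fun t => uy x t) y (Derive (fun t => uy x t) y) /\
  Derive (fun t => ux t y) x + Derive (fun t => uy x t) y = 0.
Proof.
  intros Hf Hxy u ux uy. destruct (Hf x y Hxy) as [Hd Hlap].
  destruct Hd as [Hc [Hx [Hy [[_ [Hxx _]] [_ [_ [Hyy _]]]]]]].
  split; [exact Hc |].
  do 4 (split; [now apply Derive_correct |]). exact Hlap.
Qed.

Lemma continuity_2d_pt_swap (u : R -> R -> R) (x y : R) :
  continuity_2d_pt u x y -> continuity_2d_pt (fun a b => u b a) y x.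
Proof. intros H eps. destruct (H eps) as [d Hd]. exists d. auto. Qed.

(** Go from [z] to [w] by a horizontal and a vertical leg. The symmetric difference estimate on the
    square of half side [d / 4] about the midpoint of a leg costs [12 * M / d] per unit length. *)
Lemma harmonic_lipschitz (G : C -> Prop) (f : C -> R) (z : C) (d M : R) :
  harmonic G f -> 0 < d -> 0 <= M ->
  (forall w, Cmod (z - w) < d -> G w) ->
  (forall p q, Cmod (z - p) < d -> Cmod (z - q) < d -> Rabs (f p - f q) <= 2 * M) ->
  forall w, Cmod (z - w) < / 2 * d ->
    Rabs (f z - f w) <= 24 * M / d * Cmod (z - w).
Proof.
  intros Hf Hd HM HG Hosc w Hzw.
  destruct z as [x1 y1], w as [x2 y2].
  assert (Hmod : Cmod ((x1, y1) - (x2, y2)) = Cmod (x1 - x2, y1 - y2)) by reflexivity.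
  rewrite Hmod in *. clear Hmod.
  destruct (Cmod_ge_components (x1 - x2) (y1 - y2)) as [Hx Hy].
  (* The centre [(a, b)] is less than [d / 2] away from [z] and the square adds at most
     [d / 4 + d / 4], so it stays in the disc. *)
  assert (Hsquare : forall a b p q,
    Rabs (x1 - a) <= Rabs (x1 - x2) -> Rabs (y1 - b) <= Rabs (y1 - y2) ->
    Rabs (p - a) <= d / 4 -> Rabs (q - b) <= d / 4 -> Cmod ((x1, y1) - (p, q)) < d).
  { intros a b p q Ha Hb Hp Hq.
    pose proof (Cmod_minus_triangle (x1, y1) (a, b) (p, q)) as H1.
    assert (H2 : Cmod ((x1, y1) - (a, b)) <= Cmod (x1 - x2, y1 - y2))
      by (apply Cmod_le_components; assumption).
    assert (H3 : Cmod ((a, b) - (p, q)) <= Rabs (a - p) + Rabs (b - q))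
      by apply Cmod_le_sum.
    rewrite (Rabs_minus_sym a p), (Rabs_minus_sym b q) in H3. lra. }
  assert (Hhalf : forall a b, Rabs (a - (a + b) / 2) <= Rabs (a - b)).
  { intros a b. replace (a - (a + b) / 2) with ((a - b) * / 2) by field.
    rewrite Rabs_mult, (Rabs_pos_eq (/ 2)) by lra. pose proof (Rabs_pos (a - b)). lra. }
  assert (Hself : forall a b, Rabs (a - a) <= Rabs (a - b)).
  { intros a b. rewrite Rminus_diag, Rabs_R0. apply Rabs_pos. }
  (* A symmetric difference centred at the midpoint is an arbitrary difference. *)
  assert (Hmid : forall (g : R -> R) a b,
    (forall h, 0 <= h <= d / 4 ->
       Rabs (g ((a + b) / 2 + h) - g ((a + b) / 2 - h)) <= 6 * M * h / (d / 4)) ->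
    Rabs (a - b) <= d / 2 -> Rabs (g a - g b) <= 12 * M / d * Rabs (a - b)).
  { intros g a b Hg Hab. destruct (Rle_dec a b) as [Hle | Hle].
    - rewrite (Rabs_left1 (a - b)) in * by lra. specialize (Hg ((b - a) / 2) ltac:(lra)).
      replace ((a + b) / 2 + (b - a) / 2) with b in Hg by field.
      replace ((a + b) / 2 - (b - a) / 2) with a in Hg by field.
      rewrite (Rabs_minus_sym (g a)). apply Rle_trans with (1 := Hg).
      right. field. lra.
    - rewrite (Rabs_pos_eq (a - b)) in * by lra. specialize (Hg ((a - b) / 2) ltac:(lra)).
      replace ((a + b) / 2 + (a - b) / 2) with a in Hg by field.
      replace ((a + b) / 2 - (a - b) / 2) with b in Hg by field.
      apply Rle_trans with (1 := Hg). right. field. lra. }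
  set (u := fun a b => f (a, b)).
  set (ux := fun a b => Derive (fun t => u t b) a).
  set (uy := fun a b => Derive (fun t => u a t) b).
  set (uxx := fun a b => Derive (fun t => ux t b) a).
  set (uyy := fun a b => Derive (fun t => uy a t) b).
  assert (H1 : Rabs (f (x1, y1) - f (x2, y1)) <= 12 * M / d * Rabs (x1 - x2)).
  { apply (Hmid (fun t => f (t, y1))); [| lra].
    apply (harmonic_symmetric_difference u ux uy uxx uyy); [lra | exact HM | |].
    - intros p q Hp Hq. apply (harmonic_partials G f p q Hf), HG.
      apply (Hsquare ((x1 + x2) / 2) y1); auto.
    - intros p q p' q' Hp Hq Hp' Hq'.
      apply Hosc; apply (Hsquare ((x1 + x2) / 2) y1); auto. }
  assert (H2 : Rabs (f (x2, y1) - f (x2, y2)) <= 12 * M / d * Rabs (y1 - y2)).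
  { apply (Hmid (fun t => f (x2, t))); [| lra].
    (* The vertical leg is the horizontal case with the two variables exchanged. *)
    apply (harmonic_symmetric_difference (fun a b => u b a) (fun a b => uy b a)
      (fun a b => ux b a) (fun a b => uyy b a) (fun a b => uxx b a)); [lra | exact HM | |].
    - intros q p Hq Hp.
      destruct (harmonic_partials G f p q Hf) as [A0 [A1 [A2 [A3 [A4 A5]]]]].
      { apply HG, (Hsquare x2 ((y1 + y2) / 2)); auto using Rle_refl. }
      split; [now apply continuity_2d_pt_swap |].
      do 4 (split; [assumption |]). rewrite Rplus_comm. exact A5.
    - intros q p q' p' Hq Hp Hq' Hp'.
      apply Hosc; apply (Hsquare x2 ((y1 + y2) / 2)); auto using Rle_refl. }
  assert (Hc : 0 <= 12 * M / d) by (apply Rdiv_le_0_compat; lra).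
  replace (24 * M / d) with (12 * M / d + 12 * M / d) by (field; lra).
  replace (f (x1, y1) - f (x2, y2))
    with ((f (x1, y1) - f (x2, y1)) + (f (x2, y1) - f (x2, y2))) by ring.
  apply Rle_trans with (1 := Rabs_triang _ _). nra.
Qed.

(** * Majorants and the local class *)

Lemma majorant_scale (omega : R -> R) (c t : R) :
  is_majorant omega -> 1 <= c -> 0 < t -> omega (c * t) <= c * omega t.
Proof.
  intros Hom Hc Ht.
  assert (H := majorant_ratio _ Hom t (c * t) Ht ltac:(nra)).
  assert (H0 : 0 < c * t) by nra.
  apply Rmult_le_compat_r with (r := c * t) in H; [| lra].
  replace (omega (c * t) / (c * t) * (c * t)) with (omega (c * t)) in H by (field; lra).
  replace (omega t / t * (c * t)) with (c * omega t) in H by (field; lra).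
  exact H.
Qed.

Lemma L_boundary_abs_locL (omega : R -> R) (G : C -> Prop) (f : C -> R) :
  is_majorant omega -> open G -> (exists w, ~ G w) -> harmonic G f ->
  continuous_on G f ->
  L_boundary omega G (fun z => RtoC (Rabs (f z))) ->
  locL omega G (fun z => RtoC (f z)).
Proof.
  intros Hom HG Hne Hf Hcont [_ [K [HK HKb]]].
  (* 144 is 24 from the Lipschitz estimate times 6, where [2 * 6 = 4 * 3]: the oscillation lemma
     gives 4 and the scaling of [omega] gives 3. *)
  exists (144 * K). split; [lra |]. intros z w Hz _ Hzw.
  destruct (dist_boundary_spec G z HG Hz Hne) as [Hd [_ Hinf]].
  pose proof (fun q => disc_in_domain G z q HG Hz) as Hdisc.
  set (d := dist_boundary G z) in *. clearbody d.
  destruct (Hinf (2 * d)) as [w0 [Hw0 Hzw0]]; [lra |].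
  pose proof (majorant_nonneg _ Hom d ltac:(lra)) as Hod.
  rewrite Cmod_RtoC_minus.
  (* The monotonicity of [omega t / t] concerns positive [t] only, so coinciding points are handled
     apart. *)
  destruct (Req_dec (Cmod (z - w)) 0) as [H0 | H0].
  { apply Cmod_eq_0 in H0.
    replace w with z by (replace z with (z - w + w)%C by ring; rewrite H0; ring).
    rewrite Rminus_diag, Rabs_R0. apply Rmult_le_pos; [lra |].
    apply (majorant_nonneg _ Hom), Cmod_ge_0. }
  pose proof (Cmod_ge_0 (z - w)) as Hpos.
  assert (Hlip : Rabs (f z - f w) <= 24 * (6 * K * omega d) / d * Cmod (z - w)).
  { apply (harmonic_lipschitz G f z d); auto.
    - nra.
    - replace (2 * (6 * K * omega d)) with (4 * (3 * K * omega d)) by ring.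
      apply (oscillation_from_abs f z d (Rabs (f w0))).
      + now apply (continuous_on_subset G).
      + intros q Hq. rewrite <- Cmod_RtoC_minus.
        apply Rle_trans with (1 := HKb q w0 (Hdisc q Hq) Hw0).
        apply Rle_trans with (K * omega (3 * d)).
        * apply Rmult_le_compat_l; [lra |].
          apply (majorant_incr _ Hom); [apply Cmod_ge_0 |].
          pose proof (Cmod_minus_triangle q z w0). rewrite (Cmod_minus_sym q z) in *. lra.
        * pose proof (majorant_scale omega 3 d Hom ltac:(lra) Hd). nra. }
  apply Rle_trans with (1 := Hlip).
  pose proof (majorant_ratio _ Hom (Cmod (z - w)) d ltac:(lra) ltac:(lra)) as Hr.
  apply Rmult_le_compat_r with (r := Cmod (z - w)) in Hr; [| exact Hpos].
  replace (omega (Cmod (z - w)) / Cmod (z - w) * Cmod (z - w))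
    with (omega (Cmod (z - w))) in Hr by (field; exact H0).
  replace (24 * (6 * K * omega d) / d * Cmod (z - w))
    with (144 * K * (omega d / d * Cmod (z - w))) by (field; lra).
  apply Rmult_le_compat_l; lra.
Qed.

(** * Passage to the boundary and the equivalences *)

Lemma continuous_on_RtoC (D : C -> Prop) (g : C -> R) :
  continuous_on D g -> continuous_on D (fun z => RtoC (g z)).
Proof.
  intros Hg z Hz. apply filterlim_comp with (1 := Hg z Hz).
  intros P [e He]. exists e. intros r Hr. apply He. split; [exact Hr | apply ball_center].
Qed.

Lemma continuous_on_Rabs (D : C -> Prop) (g : C -> R) :
  continuous_on D g -> continuous_on D (fun z => Rabs (g z)).
Proof.
  intros Hg z Hz. apply filterlim_comp with (1 := Hg z Hz). apply continuous_Rabs.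
Qed.

(** Approximate the boundary point [w] by [w'] in [G]: continuity of [g] at [w] and of [omega] at
    [Cmod (z - w)] each cost at most [e / 2]. *)
Lemma L_class_L_boundary (omega : R -> R) (G : C -> Prop) (g : C -> R) :
  is_majorant omega -> continuous_on (fun z => G z \/ boundary G z) g ->
  L_class omega G (fun z => RtoC (g z)) -> L_boundary omega G (fun z => RtoC (g z)).
Proof.
  intros Hom Hg [M [HM HMG]]. split; [now apply continuous_on_RtoC |].
  exists M. split; [exact HM |]. intros z w Hz Hw. rewrite Cmod_RtoC_minus.
  apply le_epsilon. intros e He.
  set (t := Cmod (z - w)).
  assert (Ht : 0 <= t) by apply Cmod_ge_0.
  assert (He' : 0 < e / 2 / M) by (apply Rdiv_lt_0_compat; lra).
  assert (Hl : locally (omega t) (fun r => Rabs (r - omega t) < e / 2 / M))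
    by now exists (mkposreal _ He').
  destruct (majorant_cont _ Hom t Ht _ Hl) as [d1 Hd1].
  destruct (continuous_on_Cmod _ g w (e / 2) Hg (or_intror Hw)) as [d2 [Hd2 Hgw]]; [lra |].
  destruct Hw as [Hw _].
  destruct (Hw (Rmin d1 d2)) as [w' [Hw' Hww']]; [apply Rmin_pos; [apply cond_pos | lra] |].
  pose proof (Rmin_l d1 d2). pose proof (Rmin_r d1 d2).
  assert (Hom' : Rabs (omega (Cmod (z - w')) - omega t) < e / 2 / M).
  { apply Hd1; [| apply Cmod_ge_0].
    change (Rabs (Cmod (z - w') - t) < d1).
    pose proof (Cmod_minus_triangle z w w'). pose proof (Cmod_minus_triangle z w' w).
    rewrite (Cmod_minus_sym w w') in *. unfold t. apply Rabs_def1; lra. }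
  assert (Hg' := Hgw w' (or_introl Hw') ltac:(lra)).
  assert (Hzw' := HMG z w' Hz Hw'). rewrite Cmod_RtoC_minus in Hzw'.
  apply Rabs_def2 in Hom'.
  assert (M * omega (Cmod (z - w')) <= M * omega t + e / 2).
  { replace (e / 2) with (M * (e / 2 / M)) by (field; lra). nra. }
  replace (g z - g w) with ((g z - g w') + (g w' - g w)) by ring.
  pose proof (Rabs_triang (g z - g w') (g w' - g w)). lra.
Qed.

Theorem theorem2 (omega : R -> R) (G : C -> Prop) (f : C -> R)
    (Homega : is_majorant omega)
    (Hint : integral_condition omega)
    (HG : extension_domain omega G)
    (Hharm : harmonic G f)
    (Hcont : continuous_on (fun z => G z \/ boundary G z) f) :
  (L_class omega G (fun z => RtoC (f z)) <-> L_class omega G (fun z => RtoC (Rabs (f z)))) /\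
  (L_class omega G (fun z => RtoC (Rabs (f z))) <->
   L_boundary omega G (fun z => RtoC (Rabs (f z)))).
Proof.
  destruct HG as [[Hopen _] [Hne Hext]].
  assert (H1 : L_class omega G (fun z => RtoC (f z)) ->
               L_class omega G (fun z => RtoC (Rabs (f z)))).
  { intros [M [HM HMG]]. exists M. split; [exact HM |]. intros z w Hz Hw.
    apply Rle_trans with (2 := HMG z w Hz Hw).
    rewrite !Cmod_RtoC_minus. apply Rabs_triang_inv2. }
  assert (H2 : L_class omega G (fun z => RtoC (Rabs (f z))) ->
               L_boundary omega G (fun z => RtoC (Rabs (f z)))).
  { apply L_class_L_boundary; [exact Homega | now apply continuous_on_Rabs]. }
  assert (H3 : L_boundary omega G (fun z => RtoC (Rabs (f z))) ->
               L_class omega G (fun z => RtoC (f z))).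
  (* The extension property makes the local estimate global and closes the cycle of implications. *)
  { intros Hb. apply Hext. apply L_boundary_abs_locL; auto.
    apply continuous_on_subset with (2 := Hcont). auto. }
  tauto.
Qed.
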